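(* For each integer $k \geq 2$: $\lim_{t \to \infty} \iota(k,t) = \frac{1}{2}$, where $t$ ranges over the non-negative integers.
   Context: All graphs are finite and simple. $d_G(v)$ is the degree of $v$ in $G$, $\Delta(G)$ and $\delta(G)$ are the maximum and minimum degree, and $V_i(G)=\{v\in V(G) : d_G(v)=i\}$. $\chi'(G)$ is the chromatic index (least number of colors in a proper edge-coloring). For $k \geq 2$, a connected graph $G$ is $k$-critical if $\Delta(G)=k$, $\chi'(G)=k+1$ and $\chi'(G-e)=k$ for every $e \in E(G)$. $\alpha(G)$ is the maximum cardinality of an independent set of vertices of $G$, and $\iota(G)=\alpha(G)/|V(G)|$. For integers $k \geq 2$ and $t \geq 0$, $\mathcal{C}(k,t)$ is the set of $k$-critical graphs $G$ such that: (1) $\delta(G)\geq k-1$; (2) to each $v \in V_{k-1}(G)$ one can assign $k-1$ (distinguished) paths $p^t_1(v),\dots,p^t_{k-1}(v)$ in $G$ with initial vertex $v$, such that for all $v\in V_{k-1}(G)$ and all $i,j\in\{1,\dots,k-1\}$: (a) $V(p^t_i(v))\cap V_{k-1}(G)=\{v\}$; (b) $|V(p^t_i(v))|\geq 2t(k-1)+2$; (c) if $i\neq j$, then $V(p^t_i(v))\cap V(p^t_j(v))=\{v\}$; (d) if $w\in V_{k-1}(G)$ and $w\neq v$, then $V(p^t_i(v))\cap V(p^t_j(w))=\emptyset$. $\iota(k,t)=\sup\{\iota(G) : G\in\mathcal{C}(k,t)\}$. *)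

(* Defs.v *)
From mathcomp Require Import all_boot all_order all_algebra.
From mathcomp Require Import all_classical all_reals all_analysis.

Set Implicit Arguments.
Unset Strict Implicit.
Unset Printing Implicit Defensive.

Import Order.TTheory GRing.Theory Num.Theory.
Import numFieldNormedType.Exports.

Local Open Scope nat_scope.

Record sgraph := SGraph {
  vertex :> finType;
  adj : rel vertex;
  adj_sym : symmetric adj;
  adj_irr : irreflexive adj
}.

Definition edges (G : sgraph) : {set {set G}} :=
  [set [set p.1; p.2] | p : G * G & adj p.1 p.2].

Definition deg (G : sgraph) (v : G) : nat := #|[set u | adj v u]|.

Definition max_deg (G : sgraph) : nat := \max_(v : G) deg v.

(* Every degree is less than #|G|, so the default value #|G| never lowers
   the minimum. *)
Definition min_deg (G : sgraph) : nat := \big[minn/#|G|]_(v : G) deg v.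

Definition deg_class (G : sgraph) (i : nat) : {set G} := [set v | deg v == i].

Definition connected_graph (G : sgraph) : Prop :=
  0 < #|G| /\ forall x y : G, connect (@adj G) x y.

Section DeleteEdge.
Variables (G : sgraph) (e : {set G}).

Definition del_adj : rel G := [rel x y | adj x y && ([set x; y] != e)].

Lemma del_adj_sym : symmetric del_adj.
Proof. by move=> x y; rewrite /del_adj /= adj_sym finset.setUC. Qed.

Lemma del_adj_irr : irreflexive del_adj.
Proof. by move=> x; rewrite /del_adj /= adj_irr. Qed.

Definition del_edge : sgraph := SGraph del_adj_sym del_adj_irr.
End DeleteEdge.

Definition edge_type (G : sgraph) : finType := {e : {set G} | e \in edges G}.

Definition proper_edge_coloring (G : sgraph) (c : nat)
    (f : {ffun edge_type G -> 'I_c}) : bool :=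
  [forall e1 : edge_type G, forall e2 : edge_type G,
     (e1 != e2) && ~~ [disjoint val e1 & val e2] ==> (f e1 != f e2)].

Definition edge_colorable (G : sgraph) (c : nat) : bool :=
  [exists f : {ffun edge_type G -> 'I_c}, proper_edge_coloring f].

Lemma edge_colorable_ex (G : sgraph) : exists c, edge_colorable G c.
Proof.
exists #|edge_type G|; apply/existsP; exists [ffun e => enum_rank e].
apply/forallP=> e1; apply/forallP=> e2; apply/implyP=> /andP[ne _].
by rewrite !ffunE (inj_eq enum_rank_inj).
Qed.

Definition chromatic_index (G : sgraph) : nat := ex_minn (edge_colorable_ex G).

Definition critical (k : nat) (G : sgraph) : Prop :=
  [/\ connected_graph G, max_deg G = k, chromatic_index G = k.+1 &
      forall e : {set G}, e \in edges G -> chromatic_index (del_edge e) = k].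

Definition independent (G : sgraph) (S : {set G}) : bool :=
  [forall x in S, forall y in S, ~~ adj x y].

Definition indep_num (G : sgraph) : nat :=
  \max_(S : {set G} | independent S) #|S|.

Definition indep_ratio (R : realType) (G : sgraph) : R :=
  ((indep_num G)%:R / #|G|%:R)%R.

(* A path is given by its full list of vertices, which are pairwise distinct. *)
Definition path_from (G : sgraph) (v : G) (s : seq G) : Prop :=
  [/\ ohead s = Some v, sorted (@adj G) s & uniq s].

Definition path_vertices (G : sgraph) (s : seq G) : {set G} := [set x in s].

(* The values of p at vertices outside deg_class G k.-1 are irrelevant. *)
Definition distinguished_paths (k t : nat) (G : sgraph)
    (p : G -> 'I_k.-1 -> seq G) : Prop :=
  forall v : G, v \in deg_class G k.-1 -> forall i j : 'I_k.-1,
  [/\ path_from v (p v i),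
      path_vertices (p v i) :&: deg_class G k.-1 = [set v],
      2 * t * k.-1 + 2 <= #|path_vertices (p v i)|,
      i != j -> path_vertices (p v i) :&: path_vertices (p v j) = [set v] &
      forall w : G, w \in deg_class G k.-1 -> w != v ->
        path_vertices (p v i) :&: path_vertices (p w j) = finset.set0].

Definition class_C (k t : nat) (G : sgraph) : Prop :=
  [/\ critical k G, k.-1 <= min_deg G &
      exists p : G -> 'I_k.-1 -> seq G, distinguished_paths t p].

(* All the ratios lie in [0, 1], so sup is the true supremum as soon as the
   class is nonempty; sup of the empty set is 0. *)
Definition sup_ratio (R : realType) (k t : nat) : R :=
  sup [set x : R | exists2 G : sgraph, class_C k t G & x = indep_ratio R G]%classic.

(* Main.v *)
(** Upper bound: if S is independent, counting the edges between S and its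
    complement gives 2k|S| <= k|V| + |V_{k-1}|, and |V_{k-1}| (2t+2) <= |V|
    because the distinguished paths of different vertices are disjoint.

    Lower bound: start from the triangle with multiplicities 1, 1, k-1, which is
    not k-edge-colorable but becomes so when any edge is deleted, and iterate the
    Meredith extension, which replaces every vertex by a copy of K_{k,k-1}. Each
    color class misses exactly one outer vertex of a copy of K_{k,k-1}, hence a
    k-edge-coloring of the extension induces one of the original multigraph;
    conversely a coloring with one deleted edge lifts after a short Kempe change.
    So criticality is preserved, while |V| - 2 alpha never exceeds 1 and the
    distinguished paths, routed through the copies, at least double in length. *)

Require Import Defs.
From mathcomp Require Import all_boot all_order all_fingroup all_algebra.
From mathcomp Require Import zify ring lra.

Set Implicit Arguments.
Unset Strict Implicit.
Unset Printing Implicit Defensive.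

Import GRing.Theory.
Local Open Scope nat_scope.

(** * Edge colorings of simple graphs *)

Lemma edge_colorableP (G : sgraph) (c : nat) :
  edge_colorable G c <->
  exists f : {set G} -> nat,
    (forall e, e \in edges G -> f e < c) /\
    (forall e1 e2, e1 \in edges G -> e2 \in edges G -> e1 != e2 ->
       ~~ [disjoint e1 & e2] -> f e1 != f e2).
Proof.
split=> [/existsP[f /forallP fP]|[f [fc fP]]].
  exists (fun e => if insub e is Some e' then nat_of_ord (f e') else 0).
  split=> [e He|e1 e2 H1 H2 ne nd]; first by rewrite insubT /=.
  rewrite !insubT /=.
  have /forallP/(_ (Sub e2 H2))/implyP := fP (Sub e1 H1).
  by rewrite -(inj_eq val_inj) /= ne nd; apply.
apply/existsP; exists [ffun e => Ordinal (fc (val e) (valP e))].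
apply/forallP=> e1; apply/forallP=> e2; apply/implyP=> /andP[ne nd].
by rewrite !ffunE -val_eqE /=; apply: fP; rewrite ?(valP e1) ?(valP e2).
Qed.

Lemma edgesP (G : sgraph) (e : {set G}) :
  reflect (exists2 p : G * G, adj p.1 p.2 & e = [set p.1; p.2])
          (e \in edges G).
Proof.
apply: (iffP imsetP) => -[p]; first by rewrite inE => ap ->; exists p.
by move=> ap ->; exists p; rewrite ?inE.
Qed.

Lemma mem_edge2 (G : sgraph) (x y : G) : adj x y -> [set x; y] \in edges G.
Proof. by move=> axy; apply/edgesP; exists (x, y). Qed.

Lemma edges_del_edge (G : sgraph) (e e' : {set G}) :
  reflect (e' \in edges G /\ e' != e) (e' \in edges (del_edge e)).
Proof.
apply: (iffP (edgesP (G := del_edge e) _)) => [[p /andP[/= ap ne] ->]|].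
  by rewrite mem_edge2.
by case=> /edgesP[p ap ->] ne; exists p => //; apply/andP; split.
Qed.

Lemma edge_colorable_leq (G : sgraph) (c c' : nat) :
  c <= c' -> edge_colorable G c -> edge_colorable G c'.
Proof.
move=> le_cc' /edge_colorableP[f [fc fP]]; apply/edge_colorableP.
by exists f; split=> // e /fc lt; apply: leq_trans lt le_cc'.
Qed.

Lemma edge_colorable_del_edge (G : sgraph) (e : {set G}) (c : nat) :
  edge_colorable (del_edge e) c -> edge_colorable G c.+1.
Proof.
move=> /edge_colorableP[f [fc fP]]; apply/edge_colorableP.
have fc' e' : e' \in edges G -> e' != e -> f e' < c.
  by move=> He' ne; apply/fc/edges_del_edge.
exists (fun e' => if e' == e then c else f e'); split=> [e' He'|e1 e2 H1 H2 ne nd].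
  by case: (eqVneq e' e) => // ne; apply/ltnW/fc'.
case: (eqVneq e1 e) => [E1|ne1]; case: (eqVneq e2 e) => [E2|ne2].
- by rewrite E1 E2 eqxx in ne.
- by rewrite gtn_eqF // fc'.
- by rewrite ltn_eqF // fc'.
- by apply: fP => //; apply/edges_del_edge.
Qed.

Lemma edge_colorable_deg (G : sgraph) (c : nat) (v : G) :
  edge_colorable G c -> deg v <= c.
Proof.
move=> /edge_colorableP[f [fc fP]].
rewrite /deg cardE -(size_map (fun w => f [set v; w])) -[leqRHS](size_iota 0).
apply: uniq_leq_size => [|y /mapP[w]]; last first.
  by rewrite mem_enum inE => avw ->; rewrite mem_iota /= fc ?mem_edge2.
rewrite map_inj_in_uniq ?enum_uniq // => w w'.
rewrite !mem_enum !inE => avw avw' fE; apply: contra_eq fE => ne.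
apply: fP; rewrite ?mem_edge2 //; last first.
  by apply/pred0Pn; exists v; rewrite /= !inE eqxx.
apply/eqP=> /setP/(_ w); rewrite !inE eqxx orbT (negPf ne) orbF.
by case: eqP => // wv; rewrite wv adj_irr in avw.
Qed.

Lemma chromatic_index_eq (G : sgraph) (c : nat) :
  edge_colorable G c.+1 -> ~~ edge_colorable G c -> chromatic_index G = c.+1.
Proof.
move=> col ncol; rewrite /chromatic_index; case: ex_minnP => m colm min_m.
apply/eqP; rewrite eqn_leq min_m //= ltnNge; apply: contra ncol => le_mc.
exact: edge_colorable_leq colm.
Qed.

Lemma leq_min_deg (G : sgraph) (c : nat) :
  0 < #|G| -> (c <= min_deg G) <-> (forall v : G, c <= deg v).
Proof.
move=> G0; have deg_lt (v : G) : deg v <= #|G| by apply: max_card.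
split=> [le_c v|le_c]; last first.
  rewrite /min_deg; elim/big_ind: _ => //.
    by case/card_gt0P: G0 => v _; apply: leq_trans (deg_lt v).
  by move=> x y cx cy; rewrite leq_min cx.
apply: leq_trans le_c _; rewrite /min_deg.
elim: (index_enum G) (mem_index_enum v) => //= w s IHs.
by rewrite inE big_cons geq_min => /predU1P[->|/IHs->]; rewrite ?leqnn ?orbT.
Qed.

Lemma leq_indep_num (G : sgraph) (S : {set G}) :
  independent S -> #|S| <= indep_num G.
Proof. by move=> iS; rewrite /indep_num (bigD1 S) //= leq_maxl. Qed.

(** * Permutations and injections with prescribed values *)

Lemma perm3 (T : finType) (a b c x y z : T) :
  uniq [:: a; b; c] -> uniq [:: x; y; z] ->
  exists s : {perm T}, [/\ s a = x, s b = y & s c = z].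
Proof.
rewrite /= !inE !negb_or !andbT => /andP[/andP[ab ac] bc] /andP[/andP[xy xz] yz].
pose s1 := tperm a x; pose s2 := (s1 * tperm (s1 b) y)%g.
have s1a : s1 a = x by rewrite tpermL.
have s2a : s2 a = x.
  by rewrite permM s1a tpermD 1?eq_sym // -s1a (inj_eq perm_inj).
have s2b : s2 b = y by rewrite permM tpermL.
exists (s2 * tperm (s2 c) z)%g; split; rewrite permM.
- by rewrite s2a tpermD 1?eq_sym // -s2a (inj_eq perm_inj).
- by rewrite s2b tpermD 1?eq_sym // -s2b (inj_eq perm_inj).
- by rewrite tpermL.
Qed.

(** The complements of A and of its image have equal size, so matching their enumerations completes
    f. It serves to color free slots. *)
Lemma inj_in_extend (T : finType) (A : {set T}) (f : T -> T) :
  {in A &, injective f} ->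
  exists2 g : T -> T, injective g & {in A, g =1 f}.
Proof.
move=> injf; pose B := ~: A; pose D := ~: (f @: A).
have sBD : size (enum B) = size (enum D).
  by rewrite -!cardE; have := cardsC A; have := cardsC (f @: A);
     rewrite card_in_imset // -/B -/D => <- /addnI.
pose h x := nth x (enum D) (index x (enum B)).
have hD x : x \notin A -> h x \in D.
  by move=> xA; rewrite -mem_enum mem_nth // -sBD index_mem mem_enum inE.
exists (fun x => if x \in A then f x else h x) => [x y|x ->//].
case: ifPn => xA; case: ifPn => yA; first exact: injf.
- by move=> E; have:= hD _ yA; rewrite -E inE imset_f.
- by move=> E; have:= hD _ xA; rewrite E inE imset_f.
have ltx z : z \notin A -> index z (enum B) < size (enum D).
  by move=> zA; rewrite -sBD index_mem mem_enum inE.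
rewrite /h (set_nth_default x y) ?ltx // => /eqP.
rewrite nth_uniq ?enum_uniq ?ltx // => /eqP E.
have := congr1 (nth x (enum B)) E.
by rewrite !nth_index // mem_enum inE.
Qed.

(** * Multigraphs with k slots at every vertex *)

(* A loopless multigraph of maximum degree at most k = n+2, given by k slots at
   each vertex: [mate] exchanges the two ends of every edge, and its fixed
   points are the slots that carry no edge. *)
Record dgraph (n : nat) := DGraph {
  dvertex :> finType;
  mate : dvertex * 'I_n.+2 -> dvertex * 'I_n.+2;
  mateK : involutive mate;
  mate_loopless : forall x, (mate x).1 = x.1 -> mate x = x
}.

(* A k-edge-coloring also colors the free slots, so that all k colors occur at
   every vertex. *)
Definition proper_slots n (G : dgraph n) (c : G * 'I_n.+2 -> 'I_n.+2) : Prop :=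
  forall v, injective (fun i => c (v, i)).

Definition uncolorable n (G : dgraph n) : Prop :=
  forall c, proper_slots c -> ~ (forall x : G * 'I_n.+2, c (mate x) = c x).

Definition colorable_off n (G : dgraph n) (d : G * 'I_n.+2) : Prop :=
  exists2 c, proper_slots c &
    forall x : G * 'I_n.+2, x != d -> x != mate d -> c (mate x) = c x.

Definition edge_critical n (G : dgraph n) : Prop :=
  forall d : G * 'I_n.+2, mate d != d -> colorable_off d.

Definition dadj n (G : dgraph n) : rel G :=
  [rel v w | (v != w) && [exists i, (mate (v, i)).1 == w]].

Section DartGraphs.
Variables (n : nat) (G : dgraph n).
Implicit Types (v w : G) (i j : 'I_n.+2) (x d : G * 'I_n.+2).

Lemma dadjP v w :
  reflect (v <> w /\ exists i, (mate (v, i)).1 = w) (dadj v w).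
Proof.
apply: (iffP andP) => -[/eqP ne exi]; split=> //.
  by have /existsP[i /eqP <-] := exi; exists i.
by have [i <-] := exi; apply/existsP; exists i.
Qed.

Lemma mate_neq1 x : (mate x != x) = ((mate x).1 != x.1).
Proof.
by apply/idP/idP; apply: contra_neq; [exact: mate_loopless | move->].
Qed.

Lemma dadj_mate x : mate x != x -> dadj x.1 (mate x).1.
Proof.
rewrite mate_neq1 => ne; apply/dadjP; split; first by apply/eqP; rewrite eq_sym.
by exists x.2; rewrite -surjective_pairing.
Qed.

Lemma dadj_sym : symmetric (@dadj n G).
Proof.
suff imp v w : dadj v w -> dadj w v by move=> v w; apply/idP/idP; apply: imp.
case/dadjP=> ne [i iw]; apply/dadjP; split; first exact: nesym.
by exists (mate (v, i)).2; rewrite -iw -surjective_pairing mateK.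
Qed.

Lemma dadj_irr : irreflexive (@dadj n G).
Proof. by move=> v; rewrite /dadj /= eqxx. Qed.

Definition sgraph_of : sgraph := SGraph dadj_sym dadj_irr.

Definition slot v w : 'I_n.+2 := odflt ord0 [pick i | (mate (v, i)).1 == w].

Lemma mate_slot v w : dadj v w -> (mate (v, slot v w)).1 = w.
Proof.
case/dadjP=> _ [i iw]; rewrite /slot; case: pickP => [j /eqP//|/(_ i)].
by rewrite iw eqxx.
Qed.

Definition edge_of x : {set sgraph_of} := [set x.1; (mate x).1].

Lemma edge_of_mate x : edge_of (mate x) = edge_of x.
Proof. by rewrite /edge_of mateK finset.setUC. Qed.

Lemma mem_edge_of x : mate x != x -> edge_of x \in edges sgraph_of.
Proof. by move=> /dadj_mate; apply: (@mem_edge2 sgraph_of). Qed.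

Lemma edge_ofP (e : {set sgraph_of}) :
  reflect (exists2 x, mate x != x & e = edge_of x) (e \in edges sgraph_of).
Proof.
apply: (iffP idP) => [/edgesP[p /= ap ->]|[x mx ->]]; last exact: mem_edge_of.
have sp := mate_slot ap; exists (p.1, slot p.1 p.2); last by rewrite /edge_of sp.
by rewrite mate_neq1 sp eq_sym; case/andP: ap.
Qed.

(** Deleting [edge_of d] from the simple graph removes all parallels of [d] at once, so a slot
    picked for a remaining edge avoids [d] and [mate d], where alone the two ends may disagree. *)
Lemma edge_colorable_del_edge_of d :
  colorable_off d -> edge_colorable (del_edge (edge_of d)) n.+2.
Proof.
case=> c cP cd; apply/edge_colorableP.
pose f (e : {set G}) : nat :=
  if [pick x | (mate x != x) && (edge_of x == e)] is Some x then c x else 0.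
have fE (e : {set G}) v : e \in edges (del_edge (edge_of d)) -> v \in e ->
    exists2 i, e = edge_of (v, i) & f e = c (v, i).
  case/edges_del_edge=> /edge_ofP[y my ->] ned ve.
  rewrite /f; case: pickP => [x /andP[mx /eqP xE]|/(_ y)]; last first.
    by rewrite my eqxx.
  rewrite -{}xE in ve ned *.
  have nd : x != d by apply: contraNneq ned => ->.
  have nmd : x != mate d by apply: contraNneq ned => ->; rewrite edge_of_mate.
  case/set2P: ve => ->; first by exists x.2; rewrite -surjective_pairing.
  exists (mate x).2; rewrite -surjective_pairing ?edge_of_mate //.
  by rewrite cd.
exists f; split=> [e _|e1 e2 H1 H2 ne].
  by rewrite /f; case: pickP => // x _; apply: ltn_ord.
case/pred0Pn=> v /andP[/= v1 v2].
have [i E1 ->] := fE e1 v H1 v1; have [j E2 ->] := fE e2 v H2 v2.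
apply: contra_neq ne => /val_inj/cP ij.
by rewrite E1 E2 ij.
Qed.

End DartGraphs.

Arguments sgraph_of {n} G.

Definition simple n (G : dgraph n) : Prop :=
  forall (v : G) i j, mate (v, i) != (v, i) ->
    (mate (v, i)).1 = (mate (v, j)).1 -> i = j.

Section SimpleDartGraphs.
Variables (n : nat) (G : dgraph n).
Hypothesis simpleG : simple G.

Lemma edge_of_inj (v : G) i j :
  mate (v, i) != (v, i) -> edge_of (v, i) = edge_of (v, j) -> i = j.
Proof.
move=> mi /setP/(_ (mate (v, i)).1); rewrite !inE /= eqxx orbT.
have:= mi; rewrite mate_neq1 /= => /negPf-> /esym/eqP.
exact: simpleG.
Qed.

(** A k-edge-coloring of the simple graph would give distinct colors to the attached slots at each
    vertex; an injective extension then colors the free ones. *)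
Lemma uncolorable_sgraph_of :
  uncolorable G -> ~~ edge_colorable (sgraph_of G) n.+2.
Proof.
move=> unc; apply/negP=> /edge_colorableP[f [fc fP]].
pose A (v : G) := [set i | mate (v, i) != (v, i)].
have inj v : {in A v &, injective (fun i => inord (f (edge_of (v, i))) : 'I_n.+2)}.
  move=> i j; rewrite !inE => mi mj /(congr1 val) /=.
  rewrite !inordK ?fc ?mem_edge_of // => E; apply: edge_of_inj (mi) _.
  apply: contra_eq E => ne; apply: fP => //; try exact: mem_edge_of.
  by apply/pred0Pn; exists v; rewrite /= !inE eqxx.
have /fin_all_exists[g gP] v : exists g : {ffun 'I_n.+2 -> 'I_n.+2},
    injective g /\ {in A v, g =1 (fun i => inord (f (edge_of (v, i))))}.
  have [g ginj gE] := inj_in_extend (inj v).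
  exists [ffun i => g i]; split=> [i j|i iA]; last by rewrite ffunE gE.
  by rewrite !ffunE => /ginj.
apply: (unc (fun x => g x.1 x.2)) => [v|x]; first exact: (gP v).1.
have [->//|mx] := eqVneq (mate x) x.
have gE y : mate y != y -> g y.1 y.2 = inord (f (edge_of y)).
  by move=> my; rewrite (gP y.1).2 ?inE -?surjective_pairing.
by rewrite !gE ?edge_of_mate // mateK eq_sym.
Qed.

Lemma deg_sgraph_of (v : sgraph_of G) :
  deg v = #|[set i : 'I_n.+2 | mate (v : G, i) != (v : G, i)]|.
Proof.
rewrite /deg -(card_in_imset (f := fun i => (mate (v : G, i)).1)); last first.
  by move=> i j; rewrite !inE => mi _; apply: simpleG.
apply: eq_card => w; rewrite inE; apply/idP/imsetP => [vw|[i]].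
  exists (slot v w); last by rewrite mate_slot.
  by rewrite inE mate_neq1 mate_slot //= eq_sym; case/andP: vw.
by rewrite inE => /dadj_mate /= ? ->.
Qed.

Hypothesis free0 : forall (v : G) i, mate (v, i) = (v, i) -> i = ord0.

Lemma deg_sgraph_of_free (v : sgraph_of G) :
  deg v = (mate (v : G, ord0) != (v : G, ord0)) + n.+1.
Proof.
rewrite deg_sgraph_of; have [m0|m0] := eqVneq (mate (v : G, ord0)) (v : G, ord0).
  rewrite (_ : [set _ | _] = ~: [set ord0]) ?cardsC1 ?card_ord //.
  apply/setP=> i; rewrite !inE; congr negb.
  by apply/eqP/eqP => [/free0|->].
rewrite (_ : [set _ | _] = setT) ?cardsT ?card_ord //.
apply/setP=> i; rewrite !inE; apply: contra_neqT m0; rewrite negbK => /eqP mi.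
by rewrite -{1 2}(free0 mi).
Qed.

End SimpleDartGraphs.

(** * The Meredith extension *)

(* Colors and outer vertices of K_{k,k-1} are both indexed by 'I_k, and
   [out i ord0] is the color of the pendant edge at i. The edge (i0, j0) is
   deleted, and the pendant color of i1 has to become i2. If i0 = i1, two colors
   are exchanged at i0; otherwise the Kempe chain i1 - jA - i0 - j0 is switched in
   a cyclic Latin square where i1, i0, i2 are the rows 0, -1, 1. *)
Lemma gadget_coloring n (i0 i1 i2 : 'I_n.+2) (j0 : 'I_n.+1) :
  i1 != i2 -> i0 != i2 ->
  exists (out : 'I_n.+2 -> 'I_n.+2 -> 'I_n.+2)
         (inn : 'I_n.+1 -> 'I_n.+2 -> 'I_n.+2),
  [/\ forall i, injective (out i), forall j, injective (inn j),
      forall i j, (i, j) != (i0, j0) -> out i (lift ord0 j) = inn j i,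
      out i1 ord0 = i2 &
      forall i, i != i0 -> i != i1 -> out i ord0 = i].
Proof.
move=> i12 i02; have [i01|i01] := eqVneq i0 i1.
  (* In the square [i + tau s], [tau] puts color i2 on the deleted edge; exchanging slots 0 and [s0]
     at i0 moves it to the pendant edge. *)
  pose s0 := lift ord0 j0; pose tau := tperm s0 (i2 - i0)%R.
  have s0N0 : (0%R : 'I_n.+2) != s0 by apply: neq_lift.
  have tau0 : tau 0%R = 0%R.
    by rewrite /tau tpermD 1?eq_sym // eq_sym subr_eq0 eq_sym.
  exists (fun i s => i + tau (if i == i0 then tperm 0 s0 s else s))%R.
  exists (fun j i => i + tau (lift ord0 j))%R.
  split.
  - by move=> i s s' /addrI/perm_inj; case: ifP => _ // /perm_inj.
  - by move=> j i i' /addIr.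
  - move=> i j; rewrite xpair_eqE negb_and; case: eqVneq => //= _ jN.
    by rewrite tpermD // ?neq_lift // (inj_eq lift_inj) eq_sym.
  - by rewrite i01 eqxx tpermL tpermL -i01 addrC subrK.
  - by move=> i /negPf-> _; rewrite tau0 addr0.
(* For k = 2 there are no three distinct colors; for larger k a second inner vertex jA exists. *)
case: n i0 i1 i2 j0 => [|n] i0 i1 i2 j0 in i12 i02 i01 *.
  by case: i0 i1 i2 i12 i02 i01 => [[|[|?]] ?] [[|[|?]] ?] [[|[|?]] ?].
have [jA jAN] : exists jA : 'I_n.+2, jA != j0.
  have [->|ne] := eqVneq j0 ord0; first by exists ord_max.
  by exists ord0; rewrite eq_sym.
pose s0 := lift ord0 j0; pose sA := lift ord0 jA.
have sAN0 : (0%R : 'I_n.+3) != sA by apply: neq_lift.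
have s0N0 : (0%R : 'I_n.+3) != s0 by apply: neq_lift.
have sA0 : sA != s0 by rewrite (inj_eq lift_inj).
have two0 : (1 + 1 != 0 :> 'I_n.+3)%R by [].
have one0 : (1 != 0 :> 'I_n.+3)%R by apply: oner_neq0.
have [rho [rho1 rho0 rho2]] : exists rho : {perm 'I_n.+3},
    [/\ rho i1 = 0, rho i0 = -1 & rho i2 = 1]%R.
  apply: perm3; rewrite /= !inE !negb_or ?(eq_sym i1 i0) ?i01 ?i12 ?i02 //.
  by rewrite !(eq_sym 0%R) oppr_eq0 one0 (eq_sym _ 1%R) -addr_eq0 two0.
have [tau [tau0 tauA tau2]] : exists tau : {perm 'I_n.+3},
    [/\ tau 0 = 0, tau sA = 1 & tau s0 = 1 + 1]%R.
  by apply: perm3 => //; rewrite /= !inE ?sA0.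
(* An addition table with rows and colors relabeled by [rho] and slots by [tau]: row i has color i
   at slot 0, and the chain i1 - jA - i0 - j0 is colored i2, i1, i2. *)
pose T i s := (rho^-1)%g (rho i + tau s)%R.
have Ti s : injective (T^~ s) by move=> i i' /perm_inj/addIr/perm_inj.
have Ts i : injective (T i) by move=> s s' /perm_inj/addrI/perm_inj.
have T0 i : T i 0%R = i by rewrite /T tau0 addr0 permK.
have T1A : T i1 sA = i2 by rewrite /T rho1 tauA add0r -rho2 permK.
have T0A : T i0 sA = i1 by rewrite /T rho0 tauA addNr -rho1 permK.
have T00 : T i0 s0 = i2 by rewrite /T rho0 tau2 addKr -rho2 permK.
(* The switch turns the pendant color of i1 into i2 and leaves a disagreement only at the deleted
   edge. *)
pose out i s := T i (if i == i1 then tperm 0%R sA s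
                     else if i == i0 then tperm sA s0 s else s).
pose inn j i := T (if j == jA then tperm i1 i0 i else i) (lift ord0 j).
exists out, inn; split.
- by rewrite /out => i s s' /Ts; case: ifP => _; [|case: ifP => _ //];
     move=> /perm_inj.
- by rewrite /inn => j i i' /Ti; case: ifP => _ // /perm_inj.
- move=> i j; rewrite xpair_eqE negb_and /out /inn.
  have [->|jNA] := eqVneq j jA.
    rewrite -/sA !tpermR tpermL; have [->|iN1] := eqVneq i i1.
      by rewrite tpermL T0 T0A.
    have [->|iN0 _] := eqVneq i i0; first by rewrite tpermR T00 T1A.
    by rewrite tpermD // eq_sym.
  have [->|iN1 /=] := eqVneq i i1.
    by rewrite tpermD ?neq_lift // (inj_eq lift_inj) eq_sym.
  have [->/= jN0|//] := eqVneq i i0.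
  by rewrite tpermD // (inj_eq lift_inj) eq_sym.
- by rewrite /out eqxx tpermL T1A.
- by move=> i /negPf iN0 /negPf iN1; rewrite /out iN0 iN1 T0.
Qed.

Section Extension.
Variables (n : nat) (G : dgraph n).

Definition ext_vertex : finType := (G * ('I_n.+2 + 'I_n.+1))%type.

(* The Meredith extension: every vertex v of G becomes a copy of K_{k,k-1} whose
   outer vertex (v, inl i) takes over slot i of v. Slot 0 of (v, inl i) is the
   pendant one, and its slot j+1 leads to slot i of the inner vertex (v, inr j). *)
Definition ext_mate (x : ext_vertex * 'I_n.+2) : ext_vertex * 'I_n.+2 :=
  match x with
  | ((v, inl i), s) =>
      if unlift ord0 s is Some j then ((v, inr j), i)
      else (((mate (v, i)).1, inl (mate (v, i)).2), ord0)
  | ((v, inr j), i) => ((v, inl i), lift ord0 j)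
  end.

Lemma ext_mate_inr v j i :
  ext_mate ((v, inr j), i) = ((v, inl i), lift ord0 j).
Proof. by []. Qed.

Lemma ext_mate0 v i :
  ext_mate ((v, inl i), ord0) =
    (((mate (v, i)).1, inl (mate (v, i)).2), ord0).
Proof. by rewrite /ext_mate unlift_none. Qed.

Lemma ext_mate_lift v i j :
  ext_mate ((v, inl i), lift ord0 j) = ((v, inr j), i).
Proof. by rewrite /ext_mate liftK. Qed.

Arguments ext_mate : simpl never.

Lemma ext_mateK : involutive ext_mate.
Proof.
case=> [[v [i|j]] s]; last by rewrite ext_mate_inr ext_mate_lift.
case: (unliftP ord0 s) => [j|] ->; first by rewrite ext_mate_lift.
by rewrite ext_mate0 ext_mate0 -surjective_pairing mateK.
Qed.

Lemma ext_mate_loopless x : (ext_mate x).1 = x.1 -> ext_mate x = x.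
Proof.
case: x => [[v [i|j]] s] //; case: (unliftP ord0 s) => [j|] ->.
  by rewrite ext_mate_lift.
by rewrite ext_mate0 => /= -[-> ->].
Qed.

Definition ext : dgraph n := DGraph ext_mateK ext_mate_loopless.

Lemma ext_free (y : ext) (s : 'I_n.+2) :
  mate (y, s) = (y, s) ->
  exists2 i, y = (y.1, inl i) & s = ord0 /\ mate (y.1, i) = (y.1, i).
Proof.
case: y => [v [i|j]] //=; case: (unliftP ord0 s) => [j|] ->.
  by rewrite ext_mate_lift.
rewrite ext_mate0 => -[E1 E2]; exists i => //; split=> //.
by rewrite [LHS]surjective_pairing E1 E2.
Qed.

Lemma ext_free0 (y : ext) (s : 'I_n.+2) : mate (y, s) = (y, s) -> s = ord0.
Proof. by case/ext_free => i _ []. Qed.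

Lemma ext_simple : simple ext.
Proof.
case=> [v [i|j]] s s' /= _; last by case.
case: (unliftP ord0 s) => [j|] ->; case: (unliftP ord0 s') => [j'|] ->;
  by rewrite ?ext_mate_lift ?ext_mate0 //= => -[->].
Qed.

Lemma ext_attached (y : ext) : exists s, mate (y, s) != (y, s).
Proof.
case: y => v [i|j]; last by exists ord0; apply/eqP.
by exists (lift ord0 ord0); rewrite /= ext_mate_lift; apply/eqP.
Qed.

(** Each of the k-1 inner vertices over v meets the pendant color of i at its own outer vertex, and
    never at one whose pendant edge has that color. Two equal pendant colors would leave only k-2
    outer vertices, so the pendant colors form a proper coloring of G. *)
Lemma ext_uncolorable : uncolorable G -> uncolorable ext.
Proof.
move=> unc c cP cm; pose b x := c ((x.1, inl x.2), ord0).
apply: (unc b) => [v i i' E|x]; last first.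
  have := cm ((x.1, inl x.2), ord0).
  by rewrite /= ext_mate0 -surjective_pairing.
have surj j : exists a, c ((v, inr j) : ext, a) = b (v, i).
  by have [g _ gK] := injF_bij (cP (v, inr j)); exists (g (b (v, i))).
have /fin_all_exists[r rP] := surj.
have rE j : c ((v, inl (r j)), lift ord0 j) = b (v, i).
  by rewrite -(rP j) -(cm ((v, inr j), r j)).
have rinj : injective r.
  move=> j j' rjj'; apply/(@lift_inj _ ord0)/(cP (v, inl (r j))).
  by rewrite rE rjj' rE.
have rN a j : b (v, a) = b (v, i) -> r j != a.
  move=> ba; apply/eqP => ra.
  have /eqP: c ((v, inl (r j)) : ext, lift ord0 j) = c ((v, inl (r j)) : ext, ord0).
    by rewrite rE ra.
  by rewrite (inj_eq (cP _)) eq_sym (negPf (neq_lift _ _)).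
apply/eqP/idPn => ii'.
have : #|[set r j | j in setT]| <= #|~: [set i; i']|.
  apply/subset_leq_card/subsetP => _ /imsetP[j _ ->].
  by rewrite !inE negb_or !rN.
rewrite card_imset // cardsT card_ord.
have := cardsC [set i; i']; rewrite cards2 ii' card_ord => -[].
by rewrite add0n => ->; rewrite ltnn.
Qed.

Lemma colorable_off_mate (H : dgraph n) (d : H * 'I_n.+2) :
  colorable_off (mate d) -> colorable_off d.
Proof.
by case=> c cP cd; exists c => // x x1 x2; apply: cd; rewrite ?mateK.
Qed.

(** If the deleted slot i, or a free slot i', carried the color of the far end, exchanging the
    colors of i and i' at v would color all of G. *)
Lemma missing_color (c : G * 'I_n.+2 -> 'I_n.+2) (v : G) i i' :
    uncolorable G -> proper_slots c -> mate (v, i) != (v, i) ->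
    (forall x, x != (v, i) -> x != mate (v, i) -> c (mate x) = c x) ->
    i' = i \/ mate (v, i') = (v, i') ->
  c (v, i') != c (mate (v, i)).
Proof.
move=> unc cP mi cm i'P; apply/eqP=> E.
pose b x := c (x.1, if x.1 == v then tperm i i' x.2 else x.2).
have bN x : x.1 != v -> b x = c x.
  by rewrite /b => /negPf->; rewrite -surjective_pairing.
have bi : b (v, i) = c (v, i') by rewrite /b eqxx tpermL.
have mv : (mate (v, i)).1 != v by rewrite -(mate_neq1 (v, i)).
have bD x : mate x != x -> x != (v, i) -> b x = c x.
  case: x => w a /= ma wa; rewrite /b /=; case: eqVneq => // wv.
  rewrite wv in ma wa *; rewrite tpermD //.
    by apply: contraNneq wa => ->.
  apply/eqP => i'a; rewrite -i'a in ma wa.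
  by case: i'P => [ii'|fi']; [rewrite ii' eqxx in wa | rewrite fi' eqxx in ma].
apply: (unc b) => [w a a' /cP|x].
  by case: ifP => _ // /perm_inj.
have [->//|mx] := eqVneq (mate x) x.
have [->|x1] := eqVneq x (v, i); first by rewrite bi E bN.
have [xE|x2] := eqVneq x (mate (v, i)).
  by rewrite xE mateK bi E bN.
have x3 : mate x != (v, i) by apply: contraNneq x2 => <-; rewrite mateK.
have mmx : mate (mate x) != mate x by rewrite mateK eq_sym.
by rewrite !bD ?cm.
Qed.

(** A deleted pendant edge reduces to the same edge of G. For an edge inside the copy of v, an edge
    of G at v is deleted instead, and the gadget gives its pendant edge the color of the far end. *)
Lemma ext_edge_critical :
    uncolorable G -> (forall v : G, exists i, mate (v, i) != (v, i)) ->
  edge_critical G -> edge_critical ext.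
Proof.
move=> unc att crit.
suff in_case v i s : mate ((v, inl i) : ext, s) != ((v, inl i), s) ->
    colorable_off (((v, inl i), s) : ext * 'I_n.+2).
  case=> [[v [i|j]] s] md; first exact: in_case.
  by apply: colorable_off_mate; apply: in_case; rewrite /= ext_mate_lift; apply/eqP.
case: (unliftP ord0 s) => [j0|] -> md; last first.
  have md0 : mate (v, i) != (v, i).
    by apply: contraNneq md => E; rewrite /= ext_mate0 E.
  have [c cP cd] := crit _ md0.
  (* Every copy is colored by the cyclic square a + s, whose slot 0 returns the color of slot a in
     G. *)
  exists (fun x => match x with
    | ((w, inl a), s) => c (w, a + s)%R
    | ((w, inr j), a) => c (w, a + lift ord0 j)%R end).
    by case=> w [a|j] t t' /cP; [move/addrI | move/addIr].
  case=> [[w [a|j]] t] //; case: (unliftP ord0 t) => [j|] -> /=.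
    by rewrite ext_mate_lift.
  rewrite !ext_mate0 => wa1 wa2; rewrite [X in (_ + X)%R](_ : _ = 0%R) //.
  rewrite !addr0 -surjective_pairing; apply: cd.
    by apply: contraNneq wa1 => -[-> ->].
  by apply: contraNneq wa2 => <-.
(* Slot i itself if it carries an edge of G, otherwise any attached slot of v. *)
have [i1 m1 i1P] : exists2 i1, mate (v, i1) != (v, i1) &
    i = i1 \/ mate (v, i) = (v, i).
  have [mi|mi] := eqVneq (mate (v, i)) (v, i); last by exists i; [|left].
  by have [i1 m1] := att v; exists i1; [|right].
have [c cP cd] := crit _ m1.
have [g gK Kg] := injF_bij (cP v).
pose i2 := g (c (mate (v, i1))).
have c2 : c (v, i2) = c (mate (v, i1)) by rewrite /i2 Kg.
have i12 : i1 != i2.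
  apply: contra_neq (missing_color unc cP m1 cd (or_introl erefl)).
  by rewrite -c2 => <-.
have i02 : i != i2.
  by apply: contra_neq (missing_color unc cP m1 cd i1P); rewrite -c2 => <-.
have [out [inn [outP innP oi out1 out0]]] := gadget_coloring j0 i12 i02.
(* The pendant colors after repainting slot i1; they agree along every edge of G. *)
pose P (y : G * 'I_n.+2) := if y.1 == v then c (v, out y.2 ord0) else c y.
have PN y : y.1 != v -> P y = c y by rewrite /P => /negPf->.
have mv : (mate (v, i1)).1 != v by rewrite -(mate_neq1 (v, i1)).
have P1 : P (v, i1) = c (mate (v, i1)) by rewrite /P eqxx out1.
have PE y : mate y != y -> y != (v, i1) -> P y = c y.
  case: y => w a ma wa; rewrite /P /=; case: eqVneq => // wv.
  rewrite wv in ma wa *; rewrite out0 //; last by apply: contraNneq wa => ->.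
  apply/eqP => ai; rewrite ai in ma wa.
  by case: i1P => [ii1|fi]; [rewrite ii1 eqxx in wa | rewrite fi eqxx in ma].
exists (fun x => match x with
  | ((w, inl a), s) => if w == v then c (v, out a s) else c (w, a + s)%R
  | ((w, inr j), a) => if w == v then c (v, inn j a) else c (w, a + lift ord0 j)%R
  end).
  case=> w [a|j] t t'; case: eqVneq => [_|_] /cP.
  - exact: outP.
  - exact: addrI.
  - exact: innP.
  - exact: addIr.
have PM (y : G * 'I_n.+2) : P (mate y) = P y.
  have [->//|my] := eqVneq (mate y) y.
  have mmy : mate (mate y) != mate y by rewrite mateK eq_sym.
  have [->|y1] := eqVneq y (v, i1); first by rewrite P1 PN.
  have [->|y2] := eqVneq y (mate (v, i1)); first by rewrite mateK P1 PN.
  have y3 : mate y != (v, i1) by apply: contraNneq y2 => <-; rewrite mateK.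
  by rewrite !PE ?cd.
have io w a j :
    ((w, inl a), lift ord0 j) != ((v, inl i), lift ord0 j0) :> ext * 'I_n.+2 ->
    (if w == v then c (v, inn j a) else c (w, a + lift ord0 j)%R) =
    (if w == v then c (v, out a (lift ord0 j)) else c (w, a + lift ord0 j)%R).
  case: (eqVneq w v) => // -> ne; rewrite oi //; apply: contraNneq ne.
  by case=> -> ->.
case=> [[w [a|j]] t] x1 x2 /=; last first.
  apply/esym/io; apply: contraNneq x2.
  by move=> /(congr1 ext_mate); rewrite /= !ext_mate_lift => ->.
case: (unliftP ord0 t) x1 x2 => [j|] -> x1 x2; first by rewrite ext_mate_lift io.
have := PM (w, a); rewrite ext_mate0 /P /=.
rewrite -[ord0]/(0%R : 'I_n.+2) !addr0 -surjective_pairing.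
by [].
Qed.

End Extension.

Arguments ext_mate : simpl never.

(** * Connectivity, independent sets and paths in the extension *)

Section ExtensionStructure.
Variables (n : nat) (G : dgraph n).

Lemma ext_adj_inner (v : G) i j : dadj ((v, inl i) : ext G) (v, inr j).
Proof.
by apply/dadjP; split=> //; exists (lift ord0 j); rewrite /= ext_mate_lift.
Qed.

Lemma ext_adj_pendant (x : G * 'I_n.+2) :
  mate x != x -> dadj ((x.1, inl x.2) : ext G) ((mate x).1, inl (mate x).2).
Proof.
case: x => v i mx; apply/dadjP; split.
  by case=> E1 E2; case/eqP: mx; rewrite [LHS]surjective_pairing -E1 -E2.
by exists ord0; rewrite /= ext_mate0.
Qed.

Lemma ext_connected :
  (forall v w : G, connect (@dadj n G) v w) ->
  forall y z : ext G, connect (@dadj n (ext G)) y z.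
Proof.
move=> conG; pose b (v : G) : ext G := (v, inr ord0).
have csym : connect_sym (@dadj n (ext G)) by apply/sym_connect_sym/dadj_sym.
have outb (v : G) i : connect (@dadj n (ext G)) (v, inl i) (b v).
  exact/connect1/ext_adj_inner.
have toB (y : ext G) : connect (@dadj n (ext G)) y (b y.1).
  case: y => v [i|j]; first exact: outb.
  apply: connect_trans (outb v ord0).
  by rewrite csym; apply/connect1/ext_adj_inner.
have bb (v w : G) : dadj v w -> connect (@dadj n (ext G)) (b v) (b w).
  move=> vw; have mx : mate (v, slot v w) != (v, slot v w).
    by rewrite mate_neq1 (mate_slot vw) eq_sym; case/andP: vw.
  have := outb w (mate (v, slot v w)).2; apply: connect_trans.
  have := ext_adj_pendant mx; rewrite (mate_slot vw) => /connect1.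
  by apply: connect_trans; rewrite csym.
move=> y z; apply: connect_trans (toB y) _; rewrite csym.
apply: connect_trans (toB z) _; rewrite csym.
have /connectP[p] := conG y.1 z.1; elim: p (y.1) => [|w p IHp] v /=.
  by move=> _ ->.
by case/andP=> /bb vw pP lE; apply: connect_trans vw (IHp _ pP lE).
Qed.

Lemma card_ext : #|ext G| = #|G| * (n.+2 + n.+1).
Proof. by rewrite card_prod card_sum !card_ord. Qed.

(** Take outer vertices over S and inner ones over its complement. With s = |S| and N = |V|, the
    defect is preserved: (2k-1)N - 2(ks + (k-1)(N-s)) = N - 2s. *)
Lemma ext_independent (S : {set sgraph_of G}) :
  independent S -> #|G| <= 2 * #|S| + 1 ->
  exists2 S' : {set sgraph_of (ext G)},
    independent S' & #|ext G| <= 2 * #|S'| + 1.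
Proof.
move=> /forall_inP iS leS.
pose S' : {set ext G} :=
  [set y | (y.1 \in S) == (if y.2 is inl _ then true else false)].
exists S'.
  apply/forall_inP=> -[v x]; rewrite inE /= => vS.
  apply/forall_inP=> -[w y]; rewrite inE /= => wS; apply/negP=> /dadjP[ne [s]].
  case: x vS ne => [i|j] /eqP vS ne /=; last first.
    by rewrite /ext_mate => -[vw yE]; move: wS; rewrite -yE -vw vS.
  case: (unliftP ord0 s) => [j|] ->.
    by rewrite ext_mate_lift => -[vw yE]; move: wS; rewrite -yE -vw vS.
  rewrite ext_mate0 => -[vw yE]; move: wS; rewrite -yE -vw /= => /eqP mS.
  have /forall_inP/(_ _ mS)/negP[] := iS v vS.
  apply: (dadj_mate (x := (v, i))); apply/eqP => mx; apply: ne.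
  by rewrite -vw -yE mx.
have cS : #|S'| = #|S| * n.+2 + #|~: S| * n.+1.
  pose f (p : G * 'I_n.+2) : ext G := (p.1, inl p.2).
  pose g (p : G * 'I_n.+1) : ext G := (p.1, inr p.2).
  have fi : injective f by case=> v i [w j] [-> ->].
  have gi : injective g by case=> v i [w j] [-> ->].
  have -> : S' = f @: setX S setT :|: g @: setX (~: S) setT.
    apply/setP=> -[v [i|j]]; rewrite !inE /=.
      rewrite eqb_id; apply/idP/orP => [vS|[]].
      - by left; apply/imsetP; exists (v, i); rewrite // !inE vS.
      - by case/imsetP=> -[w a]; rewrite !inE andbT => wS [->].
      - by case/imsetP.
    rewrite eqbF_neg; apply/idP/orP => [vS|[]].
    - by right; apply/imsetP; exists (v, j); rewrite // !inE vS.
    - by case/imsetP.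
    - by case/imsetP=> -[w a]; rewrite !inE andbT => wS [->].
  rewrite cardsU (_ : _ :&: _ = set0) ?cards0 ?subn0.
    by rewrite !card_imset // !cardsX !cardsT !card_ord.
  apply/setP=> y; rewrite !inE; apply/andP=> -[/imsetP[p _ ->] /imsetP[q _]].
  by [].
have := cardsC S; rewrite card_ext [X in _ <= X]/= cS; move: leS; rewrite /=.
move: #|S| #|~: S| #|G| => a b N; nia.
Qed.

(** Lifts the walk u, r: each copy is crossed through its inner vertex q and left by the outer
    vertex holding the slot towards the next copy. Different q keep paths with a common start
    apart. *)
Fixpoint tour (q : 'I_n.+1) (u : G) (r : seq G) : seq (ext G) :=
  (u, inr q) :: if r is w :: r' then
      (u, inl (slot u w)) :: (w, inl (mate (u, slot u w)).2) :: tour q w r'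
    else [::].

Lemma tour_path q u a r :
  path (@dadj n G) u r -> path (@dadj n (ext G)) (u, inl a) (tour q u r).
Proof.
elim: r u a => [|w r IHr] u a /=; first by rewrite ext_adj_inner.
case/andP=> uw pr; rewrite IHr // ext_adj_inner dadj_sym ext_adj_inner !andbT /=.
have mx : mate (u, slot u w) != (u, slot u w).
  by rewrite mate_neq1 (mate_slot uw) eq_sym; case/andP: uw.
by have := ext_adj_pendant mx; rewrite /= (mate_slot uw).
Qed.

Lemma tour_sub q u r y : y \in tour q u r -> y.1 \in u :: r.
Proof.
elim: r u => [|w r IHr] u; first by rewrite !inE => /eqP ->.
rewrite !inE => /or4P[/eqP->|/eqP->|/eqP->|/IHr]; rewrite /= ?eqxx ?orbT //.
by rewrite inE => ->; rewrite orbT.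
Qed.

(** The entry vertex of a copy differs from its exit vertex because slot a does not lead into r,
    whereas the exit slot leads to the head of r. *)
Lemma tour_uniq q u a r :
  path (@dadj n G) u r -> uniq (u :: r) -> (mate (u, a)).1 \notin r ->
  uniq (((u, inl a) : ext G) :: tour q u r).
Proof.
elim: r u a => [|w r IHr] u a.
  by move=> _ _ _; rewrite /= inE andbT; apply/eqP.
move=> /= /andP[uw pr] /and3P[]; rewrite !inE !negb_or => /andP[uNw uNr] wNr ur.
move=> /andP[mNw mNr].
set b := (mate _).2.
have uNt y : y \in ((w, inl b) : ext G) :: tour q w r -> u != y.1.
  rewrite inE => /predU1P[->//|/tour_sub]; apply: contraTneq => <-.
  by rewrite inE negb_or uNw.
have uN x : ((u, x) : ext G) \notin (w, inl b) :: tour q w r.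
  by apply/negP=> /uNt /=; rewrite eqxx.
have := uN (inl a); have := uN (inr q); have := uN (inl (slot u w)).
rewrite !inE !negb_or => /andP[-> ->] /andP[-> ->] /andP[-> ->].
have /= /andP[-> ->] : uniq (((w, inl b) : ext G) :: tour q w r).
  apply: IHr => //; first by rewrite /= wNr.
  have -> : (w, b) = mate (u, slot u w).
    by rewrite [RHS]surjective_pairing (mate_slot uw).
  by rewrite mateK.
rewrite !andbT -andbA; apply/and3P; split; apply/eqP => // -[E].
by rewrite E (mate_slot uw) eqxx in mNw.
Qed.

Lemma size_tour q u r : size (tour q u r) = 3 * size r + 1.
Proof. by elim: r u => //= w r IHr u; rewrite IHr; lia. Qed.

(** Separates two tours from the same vertex: the underlying paths being disjoint, they could meet
    only in the first copy, where a tour has at most two vertices. *)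
Lemma tour_start q u r x :
  uniq (u :: r) -> ((u, x) : ext G) \in tour q u r ->
  x = inr q \/ (exists2 w, ohead r = Some w & x = inl (slot u w)).
Proof.
case: r => [|w r]; first by rewrite inE => _ /eqP[->]; left.
rewrite /= !inE negb_or => /andP[/andP[uw ur] _].
case/or4P=> [/eqP[->]|/eqP[->]|/eqP[E]|/tour_sub /=]; first by left.
- by right; exists w.
- by rewrite E eqxx in uw.
- by rewrite inE (negPf uw) (negPf ur).
Qed.

Lemma tour_attached q u r y :
  path (@dadj n G) u r -> y \in tour q u r ->
  forall s : 'I_n.+2, mate (y, s) != (y, s).
Proof.
have inner (v : G) j s : mate ((v, inr j) : ext G, s) != ((v, inr j), s).
  by apply/eqP.
have outer (v : G) i s : mate (v, i) != (v, i) ->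
    mate ((v, inl i) : ext G, s) != ((v, inl i), s).
  by move=> mx; apply: contraNneq mx => /ext_free[a [->] [_ /= ->]].
elim: r u => [|w r IHr] u.
  by move=> _ /=; rewrite inE => /eqP->; apply: inner.
case/andP=> uw pr /=; rewrite !inE.
have mx : mate (u, slot u w) != (u, slot u w).
  by rewrite mate_neq1 (mate_slot uw) eq_sym; case/andP: uw.
case/or4P=> [/eqP->|/eqP->|/eqP->|]; [exact: inner | | | exact: IHr].
  by move=> s; apply: outer.
move=> s; apply: outer.
have -> : (w, (mate (u, slot u w)).2) = mate (u, slot u w).
  by rewrite [RHS]surjective_pairing (mate_slot uw).
by rewrite mateK eq_sym.
Qed.

(* [r v q] is the q-th distinguished path at v without its initial vertex v. *)
Definition path_system (L : nat) : Prop :=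
  exists r : G -> 'I_n.+1 -> seq G,
  forall v : G, mate (v, ord0) = (v, ord0) -> forall q,
  [/\ path (@dadj n G) v (r v q) /\ uniq (v :: r v q),
      L <= (size (r v q)).+1,
      forall w, w \in r v q -> mate (w, ord0) != (w, ord0),
      forall q' w, q != q' -> w \in r v q -> w \notin r v q' &
      forall v' q' w, mate (v', ord0) = (v', ord0) -> v' != v ->
        w \in v :: r v q -> w \notin v' :: r v' q'].

Lemma path_system1 : path_system 1.
Proof.
exists (fun _ _ => [::]) => v fv q; split=> // v' q' w fv' ne.
by rewrite !inE => /eqP->; rewrite eq_sym.
Qed.

End ExtensionStructure.

(** By [free0], a vertex with a free slot in the extension is the outer vertex 0 over such a vertex
    of G, so the tours over the old paths apply. *)
Lemma ext_path_system n (G : dgraph n) (L : nat) :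
  (forall (v : G) i, mate (v, i) = (v, i) -> i = ord0) ->
  path_system G L -> path_system (ext G) (2 * L).
Proof.
move=> free0 [r rP].
exists (fun y q => tour q y.1 (r y.1 q)) => y fy q.
have freeE z : mate (z : ext G, ord0) = (z, ord0) ->
    z = (z.1, inl ord0) /\ mate (z.1, ord0) = (z.1, ord0).
  by case/ext_free=> i zE [_ m]; have i0 := free0 _ _ m; rewrite i0 in zE m.
have [yE fv] := freeE y fy; set v := y.1 in yE fv *.
have [[pv uv] szv _ dq dv] := rP v fv q.
split.
- rewrite yE; split; first exact: tour_path.
  by apply: tour_uniq => //; rewrite fv /=; case/andP: uv.
(* If the old path has l vertices after v, the new one has 3l + 2 >= 2(l + 1) in all. *)
- rewrite size_tour; lia.
- by move=> z /(tour_attached pv).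
- move=> q' [w x] ne wq; apply/negP=> wq'.
  have [[pv' uv'] _ _ _ _] := rP v fv q'.
  have wv : w = v.
    have := tour_sub wq; have := tour_sub wq'; rewrite /= !inE.
    case/predU1P=> // w1; case/predU1P=> // w2.
    by have := dq _ _ ne w2; rewrite w1.
  rewrite wv in wq wq'.
  have := tour_start uv wq; have := tour_start uv' wq'.
  case=> [->|[a ha ->]] [[E]|[b hb [E]]] //; first by rewrite E eqxx in ne.
  (* Equal exit slots would lead to the same second vertex of both paths. *)
  move: ha hb uv' uv pv pv' (dq q' a ne).
  case: (r v q') => [|a' r1] //= [->]; case: (r v q) => [|b' r2] //= [->] _ _.
  case/andP=> vb _ /andP[va _].
  by rewrite -(mate_slot vb) -E (mate_slot va) !inE !eqxx => /(_ isT).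
- move=> z q' x fz ne xy; have [zE fv'] := freeE z fz.
  have ne' : z.1 != v by apply: contraNneq ne => E; rewrite zE yE E.
  have x1 : x.1 \in v :: r v q.
    by move: xy; rewrite inE => /predU1P[->|/tour_sub //]; rewrite inE eqxx.
  have := dv _ q' _ fv' ne' x1; apply: contra.
  by rewrite inE => /predU1P[->|/tour_sub //]; rewrite inE eqxx.
Qed.

(** * Graphs in C(k, t) *)

Section FatTriangle.
Variable n : nat.

Let slot1 : 'I_n.+2 := lift ord0 (ord0 : 'I_n.+1).

(* Vertices [Some true] and [Some false] are joined by k-1 parallel edges, and
   each of them is joined to [None] by one edge. *)
Definition triangle_mate (x : option bool * 'I_n.+2) : option bool * 'I_n.+2 :=
  match x with
  | (Some b, i) =>
      if i == ord0 then (None, if b then ord0 else slot1) else (Some (~~ b), i)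
  | (None, i) =>
      if i == ord0 then (Some true, ord0)
      else if i == slot1 then (Some false, ord0) else (None, i)
  end.

Lemma triangle_mateK : involutive triangle_mate.
Proof.
case=> [[b|] i] /=.
  case: (eqVneq i ord0) => [->|i0] /=; first by case: b.
  by rewrite (negPf i0) negbK.
case: (eqVneq i ord0) => [->//|i0] /=; case: (eqVneq i slot1) => [->//|i1] /=.
by rewrite (negPf i0) (negPf i1).
Qed.

Lemma triangle_loopless x : (triangle_mate x).1 = x.1 -> triangle_mate x = x.
Proof.
case: x => [[b|] i] /=; first by case: ifP => // _ [] /eqP; case: b.
by case: ifP => // _; case: ifP.
Qed.

Definition triangle : dgraph n := DGraph triangle_mateK triangle_loopless.

Lemma triangle_connected (v w : triangle) : connect (@dadj n triangle) v w.
Proof.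
have [->|ne] := eqVneq v w; first exact: connect0.
apply/connect1/dadjP; split; first exact/eqP.
case: v w ne => [a|] [b|] //= ne.
- by exists slot1; rewrite /= (_ : Some b = Some (~~ a)) //; case: a b ne => [] [].
- by exists ord0.
- by case: b ne => _; [exists ord0 | exists slot1].
Qed.

(** The k-1 parallel edges use the same colors at both ends, so the remaining color also agrees, and
    both edges at [None] would get it. *)
Lemma triangle_uncolorable : uncolorable triangle.
Proof.
move=> c cP cm.
have xy i : i != ord0 -> c (Some true, i) = c (Some false, i).
  by move=> i0; rewrite -(cm (Some false, i)) /= (negPf i0).
have [g gK Kg] := injF_bij (cP (Some false)).
have E : c (Some true, ord0) = c (Some false, ord0).
  have := Kg (c (Some true, ord0)); set i := g _ => iE.
  have [i0|i0] := eqVneq i ord0; first by rewrite -iE i0.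
  by move: iE; rewrite -xy // => /cP /eqP; rewrite (negPf i0).
have := cm (None, ord0); have := cm (None, slot1) => /= c1 c0.
by have /cP : c (None, ord0) = c (None, slot1) by rewrite -c1 -c0.
Qed.

Lemma triangle_edge_critical : edge_critical triangle.
Proof.
suff crit_fun d (t : option bool -> {perm 'I_n.+2}) :
    (forall x : triangle * 'I_n.+2, x != d -> x != mate d ->
       t (mate x).1 (mate x).2 = t x.1 x.2) -> colorable_off (d : triangle * 'I_n.+2).
  have vx : colorable_off ((None, ord0) : triangle * 'I_n.+2).
    apply: (crit_fun _ (fun v => if v is Some _ then tperm ord0 slot1 else 1%g)).
    case=> [[[]|] i] /=.
    - by case: (eqVneq i ord0) => [->|].
    - by case: (eqVneq i ord0) => [-> _ _|]; rewrite ?tpermL ?perm1.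
    - case: (eqVneq i ord0) => [->//|i0]; case: (eqVneq i slot1) => [-> _ _|//].
      by rewrite tpermL perm1.
  have vy : colorable_off ((None, slot1) : triangle * 'I_n.+2).
    apply: (crit_fun _ (fun v => 1%g)).
    case=> [[[]|] i] /=.
    - by case: (eqVneq i ord0) => [-> _ _|]; rewrite !perm1.
    - by case: (eqVneq i ord0) => [->|] //; rewrite !perm1.
    - case: (eqVneq i ord0) => [-> _ _|i0]; first by rewrite !perm1.
      by case: (eqVneq i slot1) => [->|].
  have xy i : i != ord0 -> colorable_off ((Some true, i) : triangle * 'I_n.+2).
    move=> i0; pose s := tperm i slot1; have s0 : s ord0 = ord0 by rewrite tpermD.
    have D j : j != ord0 -> j != i -> tperm ord0 i j = j.
      by move=> j0 ji; apply: tpermD; rewrite eq_sym.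
    (* [s] gives slot i the color [slot1]; at [Some false] this color is moved to slot 0 to match
       the edge to [None], so only the deleted edge disagrees. *)
    apply: (crit_fun _ (fun v => match v with
      | None => 1%g | Some true => s | Some false => tperm ord0 i * s end)%g).
    case=> [[[]|] j] /=.
    - case: (eqVneq j ord0) => [-> _ _|j0]; first by rewrite perm1 s0.
      case: (eqVneq j i) => [->|ji _ _]; first by rewrite eqxx.
      by rewrite permM D.
    - case: (eqVneq j ord0) => [-> _ _|j0].
        by rewrite perm1 permM tpermL tpermL.
      rewrite (negPf i0) /=; case: (eqVneq j i) => [->|ji _ _]; first by rewrite eqxx.
      by rewrite permM D.
    - case: (eqVneq j ord0) => [-> _ _|j0]; first by rewrite perm1 s0.
      case: (eqVneq j slot1) => [-> _ _|] //.
      by rewrite perm1 permM tpermL tpermL.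
  case=> [[[]|] i] /=.
  - case: (eqVneq i ord0) => [-> _|i0 _]; last exact: xy.
    by apply: colorable_off_mate.
  - case: (eqVneq i ord0) => [-> _|i0 _]; first exact: colorable_off_mate.
    by apply: colorable_off_mate; rewrite /= (negPf i0); apply: xy.
  - case: (eqVneq i ord0) => [-> _ //|i0].
    by case: (eqVneq i slot1) => [->|]; rewrite ?eqxx.
move=> tP; exists (fun x => t x.1 x.2) => // v i j; exact: perm_inj.
Qed.

End FatTriangle.

(** The invariant of the iteration. [2 < #|G|] leaves a vertex of G away from both ends of any
    edge. *)
Definition good n (G : dgraph n) : Prop :=
  [/\ uncolorable G /\ edge_critical G,
      forall v : G, exists i, mate (v, i) != (v, i),
      forall v w : G, connect (@dadj n G) v w,
      2 < #|G| &
      exists2 S : {set sgraph_of G}, independent S & #|G| <= 2 * #|S| + 1].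

Lemma good_triangle n : good (triangle n).
Proof.
split; first by split; [exact: triangle_uncolorable | exact: triangle_edge_critical].
- by case=> [b|]; exists ord0; apply/eqP.
- exact: triangle_connected.
- by rewrite card_option card_bool.
exists [set None : triangle n]; last by rewrite cards1 card_option card_bool.
apply/forall_inP=> v; rewrite inE => /eqP->.
by apply/forall_inP=> w; rewrite inE => /eqP->; rewrite adj_irr.
Qed.

Lemma good_ext n (G : dgraph n) : good G -> good (ext G).
Proof.
case=> [[unc crit] att con G3 [S iS cS]]; split.
- by split; [exact: ext_uncolorable | exact: ext_edge_critical].
- exact: ext_attached.
- exact: ext_connected.
- by rewrite card_ext; nia.
- exact: ext_independent iS cS.
Qed.

Lemma good_critical n (G : dgraph n) :
  good G -> critical n.+2 (sgraph_of (ext G)).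
Proof.
move=> gG; have [[unc crit] att con G3 _] := good_ext gG.
have [_ _ _ {}G3 _] := gG.
have degE (v : sgraph_of (ext G)) :=
  deg_sgraph_of_free (@ext_simple n G) (@ext_free0 n G) v.
have deg_inner (v : G) j : deg ((v, inr j) : sgraph_of (ext G)) = n.+2.
  by rewrite degE (_ : _ != _) //; apply/eqP.
have /card_gt0P[v0 _] : 0 < #|G| by apply: leq_trans G3.
split.
- by split=> //; apply/card_gt0P; exists (v0, inr ord0).
- apply/eqP; rewrite eqn_leq; apply/andP; split.
    by apply/bigmax_leqP => v _; rewrite degE; case: (_ != _).
  by rewrite -[leqLHS](deg_inner v0 ord0) /max_deg (bigD1 (v0, inr ord0)) //= leq_maxl.
- apply: chromatic_index_eq; last exact: uncolorable_sgraph_of (@ext_simple n G) unc.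
  have [i mi] := att (v0, inr ord0).
  exact/edge_colorable_del_edge/edge_colorable_del_edge_of/crit/mi.
move=> e /edge_ofP[d md ->].
apply: chromatic_index_eq; first exact/edge_colorable_del_edge_of/crit.
apply/negP=> /edge_colorable_deg.
(* The inner vertices over a third vertex of G keep degree k, so the index cannot drop below k. *)
have [v vN] : exists v : G, v \notin [set d.1.1; (mate d).1.1].
  have : 0 < #|~: [set d.1.1; (mate d).1.1]|.
    have := cardsC [set d.1.1; (mate d).1.1]; rewrite cards2.
    by move: G3; case: (_ != _) => /=; lia.
  by case/card_gt0P=> v; rewrite inE; exists v.
move/(_ ((v, inr ord0) : sgraph_of (ext G))).
suff -> : @deg (del_edge (edge_of d)) (v, inr ord0) = n.+2 by rewrite ltnn.
rewrite -[RHS](deg_inner v ord0); apply: eq_card => w; rewrite !inE /=.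
apply: andb_idr => _; apply: contraNneq vN => /setP/(_ (v, inr ord0)).
by rewrite !inE eqxx /= => /esym/orP[] /eqP <-; rewrite eqxx ?orbT.
Qed.

(** The recursion starts at the extension of the triangle: in the triangle, [None] has k-2 free
    slots, all different from 0. *)
Lemma good_iter n s : exists G : dgraph n,
  [/\ good G, forall (v : G) i, mate (v, i) = (v, i) -> i = ord0,
      path_system G (2 ^ s) & 2 ^ s <= #|G|].
Proof.
elim: s => [|s [G [gG G0 pG cG]]].
  exists (ext (triangle n)); have gG := good_ext (good_triangle n).
  split=> //; [exact: ext_free0 | exact: path_system1 |].
  by case: gG => _ _ _ + _; apply: leq_trans.
exists (ext G); split; [exact: good_ext | exact: ext_free0 | |].
  by rewrite expnS; apply: ext_path_system.
by rewrite card_ext expnS; nia.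
Qed.

Lemma class_C_ext n (G : dgraph n) (t : nat) :
  good G -> path_system (ext G) (2 * t * n.+1 + 2) ->
  class_C n.+2 t (sgraph_of (ext G)).
Proof.
move=> gG [r rP].
have degE (v : sgraph_of (ext G)) :=
  deg_sgraph_of_free (@ext_simple n G) (@ext_free0 n G) v.
have freeP (v : sgraph_of (ext G)) :
    reflect (mate (v : ext G, ord0) = (v, ord0)) (v \in deg_class (sgraph_of (ext G)) n.+1).
  rewrite inE degE; apply: (iffP eqP) => [|->]; last by rewrite eqxx.
  by case: eqVneq => // _ /eqP; rewrite -{2}[n.+1]add0n eqn_add2r.
have crit := good_critical gG.
split=> //.
  have [[G0 _] _ _ _] := crit.
  by apply/(leq_min_deg n.+1 G0) => v; rewrite degE leq_addl.
exists (fun v q => (v : ext G) :: r v q) => v /freeP fv i j.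
have [[pv uv] szv av dq dv] := rP v fv i.
split=> //.
- apply/setP=> w; rewrite in_setI in_set1 [w \in path_vertices _]inE in_cons.
  apply/andP/eqP => [[/predU1P[//|wr] /freeP fw]|->].
    by have := av w wr; rewrite fw eqxx.
  by rewrite eqxx; split=> //; apply/freeP.
- rewrite /path_vertices cardsE (card_uniqP _) //.
- move=> ij; apply/setP=> w; rewrite !inE.
  have [//|wv /=] := eqVneq w v.
  by apply/andP=> -[wi wj]; have := dq j w ij wi; rewrite wj.
- move=> w /freeP fw wv; apply/setP=> x; rewrite [RHS]inE !inE -!in_cons.
  by apply/andP=> -[xv]; apply/negP; apply: dv.
Qed.

Lemma class_C_large n t M : exists G : sgraph,
  [/\ class_C n.+2 t G, M <= #|G| & #|G| <= 2 * indep_num G + 1].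
Proof.
(* Since 2^s > s, this exponent makes both the paths long enough and the order at least M. *)
have [G [gG G0 pG cG]] := good_iter n (2 * t * n.+1 + 2 + M).
have lt2 := ltn_expl (2 * t * n.+1 + 2 + M) (isT : 1 < 2).
exists (sgraph_of (ext G)); split.
- apply: class_C_ext => //; have [r rP] := ext_path_system G0 pG.
  exists r => v fv q; have [? le ? ? ?] := rP v fv q; split=> //.
  by apply: leq_trans le; lia.
- by rewrite [leqRHS]card_ext; nia.
have [_ _ _ _ [S iS cS]] := good_ext gG.
by apply: leq_trans cS _; rewrite leq_add2r leq_mul2l leq_indep_num.
Qed.

(** * The upper bound on the independence number *)

Lemma indep_num_deg (G : sgraph) (k : nat) :
  k.-1 <= min_deg G -> max_deg G = k ->
  2 * k * indep_num G <= k * #|G| + #|deg_class G k.-1|.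
Proof.
move=> le_min maxE; rewrite /indep_num.
have [G0|/card_gt0P[x0 _]] := posnP #|G|.
  rewrite big1 ?muln0 // => S _; apply/eqP; rewrite -leqn0 -G0; exact: max_card.
have G0 : 0 < #|G| by apply/card_gt0P; exists x0.
have /(leq_min_deg _ G0) min_le := le_min.
have le_max (v : G) : deg v <= k by rewrite -maxE /max_deg (bigD1 v) //= leq_maxl.
have [|S iS ->] := @eq_bigmax_cond _ (@independent G) (fun S => #|S|).
  apply/card_gt0P; exists finset.set0; rewrite unfold_in.
  by apply/forall_inP=> x; rewrite inE.
have degE (v : G) : deg v = \sum_w adj v w.
  by rewrite /deg -sum1_card big_mkcond; apply: eq_bigr => w _; rewrite inE; case: adj.
(* Every edge at S has its other end outside S. *)
have S_out : \sum_(v in S) deg v <= \sum_(w in ~: S) deg w.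
  under eq_bigr do rewrite degE.
  under [leqRHS]eq_bigr do rewrite degE.
  rewrite [leqLHS](eq_bigr (fun v => \sum_(w in ~: S) adj v w)) => [|v vS].
    rewrite exchange_big; apply: leq_sum => w _.
    rewrite [leqRHS](bigID (mem S)) /=; apply: leq_trans (leq_addr _ _).
    by apply: leq_sum => v _; rewrite adj_sym.
  rewrite (bigID (mem S)) /= big1 ?add0n => [|w wS].
    by apply: eq_bigl => w; rewrite inE.
  by have /forall_inP/(_ w wS)/negPf-> := forall_inP iS v vS.
(* A vertex of degree k-1 falls one short of k and is charged to V_{k-1}. *)
have S_in : k * #|S| <= \sum_(v in S) deg v + #|deg_class G k.-1|.
  rewrite mulnC -sum_nat_const.
  apply: leq_trans (_ : \sum_(v in S) (deg v + (v \in deg_class G k.-1)) <= _).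
    apply: leq_sum => v _; have := min_le v; have := le_max v; rewrite inE.
    by case: eqVneq => /=; lia.
  rewrite big_split leq_add2l -sum1_card [leqRHS]big_mkcond /=.
  rewrite [leqRHS](bigID (mem S)) /=; apply: leq_trans (leq_addr _ _).
  by apply: leq_sum => v _; case: (_ \in _).
have out_le : \sum_(w in ~: S) deg w <= k * #|~: S|.
  by rewrite mulnC -sum_nat_const; apply: leq_sum.
have := cardsC S; nia.
Qed.

(** Choosing one path for each vertex of V_{k-1} gives pairwise disjoint sets of at least 2t(k-1) +
    2 >= 2t + 2 vertices. *)
Lemma deg_class_paths (G : sgraph) (k t : nat) (p : G -> 'I_k.-1 -> seq G) :
  1 < k -> distinguished_paths t p ->
  #|deg_class G k.-1| * (2 * t + 2) <= #|G|.
Proof.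
case: k p => [|[|k]] // p _ pP; set A := deg_class _ _ in pP *.
pose F v := path_vertices (p v ord0).
rewrite -sum_nat_const; apply: leq_trans (_ : \sum_(v in A) #|F v| <= _).
  apply: leq_sum => v vA; have [_ _ + _ _] := pP v vA ord0 ord0.
  by apply: leq_trans; rewrite /=; nia.
have FE (v : G) : #|F v| = \sum_x (x \in F v).
  by rewrite -sum1_card big_mkcond; apply: eq_bigr => w _; case: (_ \in _).
under eq_bigr do rewrite FE.
rewrite exchange_big -sum1_card; apply: leq_sum => x _.
have -> : \sum_(v in A) (x \in F v) = #|[set v in A | x \in F v]|.
  rewrite -sum1_card big_mkcond [RHS]big_mkcond; apply: eq_bigr => v _.
  by rewrite inE; case: (v \in A) => //=; case: (_ \in _).
apply/card_le1_eqP => v w; rewrite in_set => /andP[vA xv].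
rewrite in_set => /andP[wA xw].
apply/eqP/idPn; have [_ _ _ _ dis] := pP v vA ord0 ord0.
move=> vw; have /setP/(_ x) := dis w wA vw.
by rewrite in_setI xv xw inE.
Qed.

(** Multiply the degree bound by 2t + 2, replace |V_{k-1}|(2t + 2) by |V| <= k|V|, and cancel k. *)
Lemma class_C_indep_num (G : sgraph) (k t : nat) :
  1 < k -> class_C k t G ->
  2 * (2 * t + 2) * indep_num G <= (2 * t + 3) * #|G|.
Proof.
move=> k1 [[_ maxE _ _] minE [p pP]].
have := indep_num_deg minE maxE; have := deg_class_paths k1 pP.
set m := #|deg_class _ _|; move: (indep_num G) #|G| m => a N m mN aN.
have : k * (2 * (2 * t + 2) * a) <= k * ((2 * t + 3) * N) by nia.
by rewrite leq_pmul2l //; apply: ltnW.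
Qed.

(** * Comparison with one half *)

From mathcomp Require Import all_classical all_reals all_analysis.
Import Order.TTheory GRing.Theory Num.Theory.
Import numFieldNormedType.Exports.
Local Open Scope classical_set_scope.
Local Open Scope ring_scope.

(** (2t+3)/(4t+4) = 1/2 + 1/(4t+4), which is at most 1/2 + 1/(t+1). *)
Lemma indep_ratio_le (R : realType) (G : sgraph) (k t : nat) :
  (1 < k)%N -> class_C k t G -> indep_ratio R G <= 1 / 2 + harmonic t.
Proof.
move=> k1 CG; have [[[G0 _] _ _ _] _ _] := CG.
have := class_C_indep_num k1 CG; rewrite -(ler_nat R) !(natrM, natrD) => le.
have N0 : 0 < #|G|%:R :> R by rewrite ltr0n.
have t0 : 0 < t.+1%:R :> R by rewrite ltr0n.
rewrite /indep_ratio ler_pdivrMr //= -(ler_pM2r t0).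
rewrite [leRHS](_ : _ = (t.+1%:R / 2 + 1) * #|G|%:R); last by field; rewrite gt_eqF.
by rewrite -(natr1 t); nra.
Qed.

Theorem theorem2p11 (R : realType) (k : nat) (hk : (2 <= k)%N) :
  (fun t : nat => sup_ratio R k t) @ \oo --> (1 / 2 : R).
Proof.
pose lo (t : nat) : R := 1 / 2 - harmonic t; pose hi (t : nat) : R := 1 / 2 + harmonic t.
have lo_cvg : lo @ \oo --> (1 / 2 : R).
  rewrite -[X in _ --> X]subr0; apply: cvgB; [exact: cvg_cst | exact: cvg_harmonic].
have hi_cvg : hi @ \oo --> (1 / 2 : R).
  rewrite -[X in _ --> X]addr0; apply: cvgD; [exact: cvg_cst | exact: cvg_harmonic].
apply: (squeeze_cvgr _ lo_cvg hi_cvg); near=> t.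
(* A member with more than t vertices has ratio at least 1/2 - 1/(2|V|), hence at least [lo t]; it
   also makes the set under [sup] nonempty. *)
case: k hk => [|[|n]] // hk; have [G [CG ltN leN]] := class_C_large n t t.+1.
have ub : ubound [set x : R |
    exists2 G, class_C n.+2 t G & x = indep_ratio R G] (hi t).
  by move=> _ [H CH ->]; apply: indep_ratio_le CH.
apply/andP; split; last by apply: ge_sup => //; exists (indep_ratio R G), G.
apply: le_trans (_ : indep_ratio R G <= _); last first.
  by apply: ub_le_sup; [exists (hi t) | exists G].
have N0 : 0 < #|G|%:R :> R by rewrite ltr0n; apply: leq_trans ltN.
have t0 : 0 < t.+1%:R :> R by rewrite ltr0n.
have : harmonic t * #|G|%:R >= 1 :> R.
  by rewrite /= ler_pdivlMl // mulr1 ler_nat.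
move: leN; rewrite -(ler_nat R) natrD natrM /indep_ratio ler_pdivlMr // /lo.
move: (harmonic t) => h; nra.
Unshelve. all: by end_near.
Qed.
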